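(* Let $H\subset \mathrm{SL}_N(\mathbb R)$ be a non-compact semisimple group. Assume that $H$ acts continuously on a space $X$ preserving the measure $\mu$ on $X$, and that $\mathrm{Stab}_H(x)$ is discrete for every $x\in X$. Let $\{Hx_n : n\in\mathbb N\}$ be a sequence of periodic orbits in $X$ satisfying $$\mu_{Hx_n}\to\mu\quad\text{as } n\to\infty.$$ Assume further that for every $R>0$ there exists a continuous function $f_R:X\to[0,\infty)$ satisfying the following two properties: (1) $f_R(x)>0$ for $\mu$-a.e. $x\in X$; (2) if $f_R(x)>0$ for some $x\in X$, then $\mathrm{Stab}_H(x)\cap B^H(e,R)=\{e\}$. Then $H/\mathrm{Stab}_H(x_n)$ Benjamini-Schramm converges to $H$.
   Context: $e$ denotes the identity element of $H$, $I$ the identity matrix, and $\|\cdot\|$ the maximum norm on $\mathrm{Mat}_N(\mathbb R)$ with respect to the standard basis. For $R>0$, $$B^H(e,R)=\{h\in H:\ \|h-I\|<R \text{ and } \|h^{-1}-I\|<R\}.$$ Equip $H$ with the right invariant Riemannian metric induced by the Killing form, and let $B^H_{\rm Rie}(e,r)$ be the ball of radius $r$ centered at the identity with respect to this metric. For a discrete subgroup $\Delta\subset H$, the injectivity radius of $y\in H/\Delta$ is the supremum over all $r>0$ such that the map $h\mapsto hy$ is injective on $B^H_{\rm Rie}(e,r)$. For a sequence of lattices $\Delta_n\subset H$, the sequence $\{H/\Delta_n\}$ Benjamini-Schramm converges to $H$ if for every $r>0$ $$\mu_n\bigl(\{y\in H/\Delta_n:\ \text{injectivity radius of } y<r\}\bigr)\to0\quad\text{as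 } n\to\infty,$$ where $\mu_n$ is the $H$-invariant probability measure on $H/\Delta_n$. An orbit $Hx\subset X$ is called periodic if $Hx$ is a closed subset of $X$ and $\mathrm{Stab}_H(x)$ is a lattice in $H$. For a periodic orbit $Hx$, $\mu_{Hx}$ denotes the pushforward to $Hx$ (under $h\,\mathrm{Stab}_H(x)\mapsto hx$) of the $H$-invariant probability measure on $H/\mathrm{Stab}_H(x)$. *)

(* Defs.v *)
From HB Require Import structures.
From mathcomp Require Import all_boot all_order all_algebra.
From mathcomp Require Import all_classical all_reals all_analysis.

Set Implicit Arguments.
Unset Strict Implicit.
Unset Printing Implicit Defensive.

Import Order.TTheory GRing.Theory Num.Theory.
Import numFieldNormedType.Exports.

Local Open Scope classical_set_scope.
Local Open Scope ring_scope.

(* The norm and the topology of 'M[R]_N are those of the library: `|A| is the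
   maximum of the absolute values of the entries of A. *)

(** Lie algebras of matrices *)

Definition bracket (R : realType) (N : nat) (X Y : 'M[R]_N) : 'M[R]_N :=
  X *m Y - Y *m X.

Definition lie_product (R : realType) (N : nat) (U V : {vspace 'M[R]_N}) :
    {vspace 'M[R]_N} :=
  <<[seq bracket X Y | X <- vbasis U, Y <- vbasis V]>>%VS.

Definition lie_solvable (R : realType) (N : nat) (L : {vspace 'M[R]_N}) :=
  exists k, iter k (fun U => lie_product U U) L = 0%VS.

Definition lie_ideal (R : realType) (N : nat) (I L : {vspace 'M[R]_N}) :=
  (I <= L)%VS /\ forall X Y, X \in L -> Y \in I -> bracket X Y \in I.

Definition lie_semisimple (R : realType) (N : nat) (L : {vspace 'M[R]_N}) :=
  forall I, lie_ideal I L -> lie_solvable I -> I = 0%VS.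

(* The trace of ad X \o ad Y on L, computed in the basis vbasis L. *)
Definition killing (R : realType) (N : nat) (L : {vspace 'M[R]_N})
    (X Y : 'M[R]_N) : R :=
  \sum_(i < \dim L)
    coord (vbasis L) i (bracket X (bracket Y (vbasis L)`_i)).

(* Only the restriction of theta to L matters. *)
Definition cartan_involution (R : realType) (N : nat) (L : {vspace 'M[R]_N})
    (theta : 'End('M[R]_N)) :=
  [/\ forall X, X \in L -> theta X \in L,
      forall X, X \in L -> theta (theta X) = X,
      forall X Y, X \in L -> Y \in L ->
        theta (bracket X Y) = bracket (theta X) (theta Y) &
      forall X, X \in L -> X != 0 -> 0 < - killing L X (theta X)].

(** Matrix groups *)

Definition mx_subgroup (R : realType) (N : nat) (D : set 'M[R]_N) :=
  [/\ D 1%:M,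
      forall g h, D g -> D h -> D (g *m h) &
      forall g, D g -> g \in unitmx /\ D (invmx g)].

Record mx_group (R : realType) (N : nat) := MxGroup {
  carrier :> set 'M[R]_N ;
  mx_groupP : mx_subgroup carrier }.

(* The tangent space of H at the identity: the velocities at 0 of the curves
   in H through the identity. *)
Definition tangent1 (R : realType) (N : nat) (H : set 'M[R]_N) :
    set 'M[R]_N :=
  [set X | exists c : R -> 'M[R]_N,
    [/\ forall t, H (c t), c 0 = 1%:M & is_derive (0 : R) 1 c X]].

(* For a closed group H, tangent1 H is a linear subspace (closed subgroup
   theorem), so that the default value 0%VS is not used. *)
Definition lie_algebra (R : realType) (N : nat) (H : set 'M[R]_N) :
    {vspace 'M[R]_N} :=
  xget 0%VS [set L : {vspace 'M[R]_N} | [set X | X \in L] = tangent1 H].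

(* Both connected semisimple Lie subgroups of SL_N (they are closed) and
   groups of real points of semisimple algebraic subgroups of SL_N (they have
   finitely many components) are covered. *)
Definition semisimple_group (R : realType) (N : nat) (H : mx_group R N) :=
  [/\ forall h, carrier H h -> \det h = 1,
      closed H,
      finite_set [set connected_component H h | h in H] &
      lie_semisimple (lie_algebra H)].

Definition matrix_ball (R : realType) (N : nat) (H : mx_group R N) (rho : R) :
    set 'M[R]_N :=
  [set h | [/\ carrier H h, `|h - 1%:M| < rho & `|invmx h - 1%:M| < rho]].

(** The right invariant Riemannian metric on H *)

(* The Killing form B is indefinite when H is not compact; the scalar product
   it induces on the Lie algebra is, as usual, - B(X, theta Y) for a Cartan
   involution theta. *)
Definition killing_norm (R : realType) (N : nat) (H : mx_group R N)
    (theta : 'End('M[R]_N)) (X : 'M[R]_N) : R :=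
  Num.sqrt (- killing (lie_algebra H) X (theta X)).

(* Right invariance: a vector U tangent to H at g has the norm of U g^-1. *)
Definition curve_length (R : realType) (N : nat) (H : mx_group R N)
    (theta : 'End('M[R]_N)) (c : R -> 'M[R]_N) : \bar R :=
  (\int[lebesgue_measure]_(t in `[0%R, 1%R])
    (killing_norm H theta (derive1 c t *m invmx (c t)))%:E)%E.

Definition C1_curve (R : realType) (N : nat) (H : set 'M[R]_N)
    (c : R -> 'M[R]_N) :=
  [/\ forall t, derivable c t 1, continuous (derive1 c) &
      forall t, 0 <= t <= 1 -> H (c t)].

(* pw_curve H theta g h l: there is a piecewise C1 curve in H of length l
   from g to h, i.e. a finite concatenation of C1 curves. *)
Inductive pw_curve (R : realType) (N : nat) (H : mx_group R N)
    (theta : 'End('M[R]_N)) : 'M[R]_N -> 'M[R]_N -> \bar R -> Prop :=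
| PwNil g : carrier H g -> pw_curve H theta g g 0%E
| PwCons c h l : C1_curve H c -> pw_curve H theta (c 1) h l ->
    pw_curve H theta (c 0) h (curve_length H theta c + l)%E.

Definition riemannian_dist (R : realType) (N : nat) (H : mx_group R N)
    (theta : 'End('M[R]_N)) (g h : 'M[R]_N) : \bar R :=
  ereal_inf [set l | pw_curve H theta g h l].

Definition riemannian_ball (R : realType) (N : nat) (H : mx_group R N)
    (theta : 'End('M[R]_N)) (r : R) : set 'M[R]_N :=
  [set h | carrier H h /\ (riemannian_dist H theta 1%:M h < r%:E)%E].

Definition Borel (T : ptopologicalType) := g_sigma_algebraType (@open T).

(** The homogeneous space H / D *)

Definition lmul (R : realType) (N : nat) (g : 'M[R]_N) (A : set 'M[R]_N) :
    set 'M[R]_N :=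
  [set g *m a | a in A].

Definition coset_space (R : realType) (N : nat) (H : mx_group R N)
    (D : set 'M[R]_N) : Type :=
  set_type [set lmul h D | h in H].

Section coset_space_topology.
Context (R : realType) (N : nat) (H : mx_group R N) (D : set 'M[R]_N).

Definition coset_proj (h : set_type H) : coset_space H D :=
  SigSub (mem_set (imageP (fun g => lmul g D) (set_valP h))).

HB.instance Definition _ := Choice.on (coset_space H D).

Let mx_group1 : carrier H 1%:M. Proof. by case: (mx_groupP H). Qed.

HB.instance Definition _ := isPointed.Build (coset_space H D)
  (coset_proj (SigSub (mem_set mx_group1))).

(* The quotient topology. *)
Definition coset_open (U : set (coset_space H D)) := open (coset_proj @^-1` U).

Let coset_openT : coset_open [set: _].
Proof. by rewrite /coset_open preimage_setT; exact: openT. Qed.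

Let coset_openI (A B : set (coset_space H D)) :
  coset_open A -> coset_open B -> coset_open (A `&` B).
Proof. by move=> oA oB; rewrite /coset_open preimage_setI; exact: openI. Qed.

Let coset_open_bigU (I : Type) (f : I -> set (coset_space H D)) :
  (forall i, coset_open (f i)) -> coset_open (\bigcup_i f i).
Proof.
move=> of_; rewrite /coset_open preimage_bigcup.
by apply: bigcup_open => i _; exact: of_.
Qed.

HB.instance Definition _ := isOpenTopological.Build (coset_space H D)
  coset_openT coset_openI coset_open_bigU.

End coset_space_topology.

Definition invariant_probability (R : realType) (N : nat) (H : mx_group R N)
    (D : set 'M[R]_N) (nu : probability (Borel (coset_space H D)) R) :=
  forall g (A : set (Borel (coset_space H D))), carrier H g -> measurable A ->
    nu [set y | exists2 z, A z & \val y = lmul g (\val z)] = nu A.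

Definition discrete_set (T : topologicalType) (D : set T) :=
  forall a, D a -> isolated D a.

Definition is_lattice (R : realType) (N : nat) (H : mx_group R N)
    (D : set 'M[R]_N) :=
  [/\ mx_subgroup D, D `<=` H, discrete_set D &
      exists nu : probability (Borel (coset_space H D)) R,
        invariant_probability nu].

Definition injectivity_radius (R : realType) (N : nat) (H : mx_group R N)
    (theta : 'End('M[R]_N)) (D : set 'M[R]_N) (y : coset_space H D) : \bar R :=
  ereal_sup [set r%:E | r in [set r : R | 0 < r /\
    set_inj (riemannian_ball H theta r) (fun h => lmul h (\val y))]].

(* nu n is the H-invariant probability measure on H / D n. Since the measures
   of the library are meaningful on measurable sets only, we use the outer
   measure of nu n, which agrees with nu n on them (measurable_mu_extE). *)
Definition benjamini_schramm (R : realType) (N : nat) (H : mx_group R N)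
    (theta : 'End('M[R]_N)) (D : nat -> set 'M[R]_N)
    (nu : forall n, probability (Borel (coset_space H (D n))) R) :=
  forall r : R, 0 < r ->
    (fun n => ((nu n)^*)%mu
       [set y : Borel (coset_space H (D n)) |
         (injectivity_radius theta y < r%:E)%E]) @ \oo --> 0%E.

(** Actions and periodic orbits *)

Definition is_action (R : realType) (N : nat) (H : mx_group R N) (X : Type)
    (act : 'M[R]_N -> X -> X) :=
  (forall x, act 1%:M x = x) /\
  (forall g h x, carrier H g -> carrier H h ->
    act (g *m h) x = act g (act h x)).

Definition continuous_action (R : realType) (N : nat) (H : mx_group R N)
    (X : topologicalType) (act : 'M[R]_N -> X -> X) :=
  is_action H act /\
  {within carrier H `*` [set: X],
    continuous (fun p : 'M[R]_N * X => act p.1 p.2)}.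

Definition measure_preserving (R : realType) (N : nat) (H : mx_group R N)
    (X : ptopologicalType) (act : 'M[R]_N -> X -> X)
    (mu : {measure set (Borel X) -> \bar R}) :=
  forall g (A : set (Borel X)), carrier H g -> measurable A ->
    mu (act g @^-1` A) = mu A.

Definition stab (R : realType) (N : nat) (H : mx_group R N) (X : Type)
    (act : 'M[R]_N -> X -> X) (x : X) : set 'M[R]_N :=
  [set h | carrier H h /\ act h x = x].

Definition periodic_orbit (R : realType) (N : nat) (H : mx_group R N)
    (X : topologicalType) (act : 'M[R]_N -> X -> X) (x : X) :=
  closed [set act h x | h in H] /\ is_lattice H (stab H act x).

(* The map h Stab_H(x) |-> h x. A point y of H / Stab_H(x) is a coset, and h
   can be taken to be any of its elements. *)
Definition orbit_map (R : realType) (N : nat) (H : mx_group R N)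
    (X : ptopologicalType) (act : 'M[R]_N -> X -> X) (x : X)
    (y : Borel (coset_space H (stab H act x))) : Borel X :=
  act (get (\val y)) x.

(* Weak convergence of Borel measures on X, against bounded continuous
   functions. *)
Definition weak_cvg (R : realType) (X : ptopologicalType)
    (m : nat -> set (Borel X) -> \bar R) (mu : set (Borel X) -> \bar R) :=
  forall phi : X -> R, continuous phi ->
    (exists C : R, forall x, `|phi x| <= C) ->
    (fun n => \int[m n]_(x in [set: Borel X]) (phi x)%:E)%E @ \oo -->
      (\int[mu]_(x in [set: Borel X]) (phi x)%:E)%E.

(* Main.v *)
(* A point y of H / Stab(x) has injectivity radius less than r only if two
   distinct a, b in the Riemannian ball of radius r satisfy a y = b y, i.e. only
   if b^-1 a <> e stabilizes the point z of the orbit of x corresponding to y.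
   Riemannian balls are bounded for the matrix norm: on the Lie algebra, the
   norm given by the Cartan involution dominates the matrix norm up to a
   constant, so that along a curve c in H the derivative of ln (1 + |c|^2) is
   at most a constant times the speed of c; inverses are controlled by
   the adjugate matrix, since H is contained in SL_N. Hence b^-1 a lies in a
   matrix ball whose radius rho depends on r only, and f_rho z = 0. The measure
   of { f_rho = 0 } is at most the integral of max (0, 1 - k f_rho) for every k;
   weak convergence and then dominated convergence for mu conclude. *)

Require Import Defs.
From HB Require Import structures.
From mathcomp Require Import all_boot all_order all_algebra perm ring lra.
From mathcomp Require Import all_classical all_reals all_analysis.
From mathcomp Require Import measurable_realfun.

Set Implicit Arguments.
Unset Strict Implicit.
Unset Printing Implicit Defensive.

Import Order.TTheory GRing.Theory Num.Theory.
Import numFieldNormedType.Exports.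

Local Open Scope classical_set_scope.
Local Open Scope ring_scope.

(** * Estimates for the maximum norm of matrices *)

Lemma normmx_le (R : realType) m n (A : 'M[R]_(m, n)) i j : `|A i j| <= `|A|.
Proof.
by rewrite [leRHS]/Num.norm/= mx_normrE; exact: (le_bigmax _ _ (i, j)).
Qed.

Lemma normmx_bound (R : realType) m n (A : 'M[R]_(m, n)) (x : R) : 0 <= x ->
  (forall i j, `|A i j| <= x) -> `|A| <= x.
Proof.
move=> x0 Ax; rewrite [leLHS]/Num.norm/= mx_normrE.
by rewrite (bigmax_le _ x0)// => -[i j].
Qed.

Lemma normmxM_le (R : realType) m n p (A : 'M[R]_(m, n)) (B : 'M[R]_(n, p)) :
  `|A *m B| <= n%:R * (`|A| * `|B|).
Proof.
apply: normmx_bound => [|i j]; first by rewrite !mulr_ge0.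
rewrite mxE (le_trans (ler_norm_sum _ _ _))//.
rewrite (@le_trans _ _ (\sum_(k < n) `|A| * `|B|))//.
  by apply: ler_sum => k _; rewrite normrM ler_pM ?normmx_le.
by rewrite sumr_const card_ord mulr_natl.
Qed.

Lemma norm_det_le (R : realType) n (A : 'M[R]_n) :
  `|\det A| <= (n`!)%:R * `|A| ^+ n.
Proof.
rewrite (le_trans (ler_norm_sum _ _ _))//.
rewrite (@le_trans _ _ (\sum_(s : 'S_n) `|A| ^+ n))//.
  apply: ler_sum => s _; rewrite normrM normrX normrN1 expr1n mul1r normr_prod.
  have -> : `|A| ^+ n = \prod_(i < n) `|A| by rewrite prodr_const card_ord.
  apply: ler_prod => i _.
  by rewrite normr_ge0 normmx_le.
by rewrite sumr_const card_Sn mulr_natl.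
Qed.

(** Up to sign the entries of the adjugate are minors of size [n.-1], so the Leibniz bound applies.
    In determinant 1 this controls inverses. *)
Lemma normmx_adj_le (R : realType) n (A : 'M[R]_n) :
  `|\adj A| <= (n.-1)`!%:R * `|A| ^+ n.-1.
Proof.
apply: normmx_bound => [|i j]; first by rewrite mulr_ge0// exprn_ge0.
rewrite mxE /cofactor normrM normrX normrN1 expr1n mul1r.
rewrite (le_trans (norm_det_le _))// ler_wpM2l//.
apply: lerXn2r; rewrite ?nnegrE//; apply: normmx_bound => // k l.
by rewrite !mxE normmx_le.
Qed.

(** * Derivatives of matrix curves *)

Lemma is_derive_mxP (R : realType) m n (A : R -> 'M[R]_(m, n)) (t : R) D :
  is_derive t 1 A D <-> forall i j, is_derive t 1 (fun s => A s i j) (D i j).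
Proof.
split=> [[dA AD] i j|dA].
  have /derivable_mxP/(_ i j) dAij := dA.
  by apply: DeriveDef => //; rewrite -AD derive_mx// mxE.
have dA' : derivable A t 1 by apply/derivable_mxP => i j; have [] := dA i j.
apply: DeriveDef => //; rewrite derive_mx//; apply/matrixP => i j.
by rewrite mxE; have [_] := dA i j.
Qed.

Lemma is_derive_mulmx (R : realType) m n p (A : R -> 'M[R]_(m, n))
    (B : R -> 'M[R]_(n, p)) (t : R) dA dB :
  is_derive t 1 A dA -> is_derive t 1 B dB ->
  is_derive t 1 (fun s => A s *m B s) (dA *m B t + A t *m dB).
Proof.
move=> /is_derive_mxP hA /is_derive_mxP hB; apply/is_derive_mxP => i j.
have -> : (fun s => (A s *m B s) i j) =
    \sum_k ((fun s => A s i k) * (fun s => B s k j)).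
  by apply/funext => s; rewrite fct_sumE mxE.
have -> : (dA *m B t + A t *m dB) i j =
    \sum_k (A t i k *: dB k j + B t k j *: dA i k).
  rewrite !mxE -big_split/=; apply: eq_bigr => k _.
  by rewrite /GRing.scale/= addrC [X in _ + X]mulrC.
by apply: is_derive_sum => k; exact: is_deriveM.
Qed.

Lemma is_derive_mx_comp (R : realType) m n (A : R -> 'M[R]_(m, n))
    (g : R -> R) (t : R) b D :
  is_derive t 1 g b -> is_derive (g t) 1 A D ->
  is_derive t 1 (fun s => A (g s)) (b *: D).
Proof.
move=> hg /is_derive_mxP hA; apply/is_derive_mxP => i j; rewrite mxE mulrC.
exact: (@is_derive1_comp _ (fun s => A s i j)).
Qed.

(** * The tangent space at the identity as a linear subspace *)

(** By the Leibniz rule, the pointwise product of two curves through the identity has the sum of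
    their velocities. *)
Lemma tangent1D (R : realType) N (H : mx_group R N) (X Y : 'M[R]_N) :
  tangent1 H X -> tangent1 H Y -> tangent1 H (X + Y).
Proof.
move=> [c [cH c0 cX]] [d [dH d0 dY]].
have [_ HM _] := mx_groupP H.
exists (fun t => c t *m d t); split => [t| |]; first exact: HM.
  by rewrite c0 d0 mulmx1.
by have := is_derive_mulmx cX dY; rewrite c0 d0 mulmx1 mul1mx.
Qed.

Lemma tangent1Z (R : realType) N (H : mx_group R N) a (X : 'M[R]_N) :
  tangent1 H X -> tangent1 H (a *: X).
Proof.
move=> [c [cH c0 cX]].
exists (fun t => c (a * t)); split => // [|]; first by rewrite mulr0.
apply: is_derive_mx_comp; last by rewrite mulr0.
have -> : *%R a = a *: id by [].
by apply: is_derive_eq; rewrite /GRing.scale/= mulr1.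
Qed.

(* The subspace of maximal dimension contained in A is all of A. *)
Lemma vspace_of_set (F : fieldType) (vT : vectType F) (A : set vT) :
  A 0 -> (forall a u v, A u -> A v -> A (a *: u + v)) ->
  exists U : {vspace vT}, [set u | u \in U] = A.
Proof.
move=> A0 Alin.
pose P n :=
  `[< exists2 U : {vspace vT}, [set u | u \in U] `<=` A & \dim U = n >].
have exP : exists n, P n.
  exists 0%N; apply/asboolP; exists 0%VS; last by rewrite dimv0.
  by move=> u /=; rewrite memv0 => /eqP ->.
have ubP n : P n -> (n <= \dim {:vT})%N.
  by move=> /asboolP[U _ <-]; rewrite dimvS ?subvf.
have := ex_maxnP exP ubP; case=> n /asboolP[U UA <-] maxU.
exists U; apply/seteqP; split => // u Au /=.
have : (\dim (U + <[u]>) <= \dim U)%N.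
  apply: maxU; apply/asboolP; exists (U + <[u]>)%VS => // w /=.
  move=> /memv_addP[v vU [_ /vlineP[k ->] ->]].
  by rewrite addrC; apply: Alin => //; exact: UA.
rewrite (geq_leqif (dimv_leqif_sup (addvSl U <[u]>))) => /subvP; apply.
by rewrite (subvP (addvSr _ _))// memv_line.
Qed.

(* tangent1 H consists of velocities of curves that need only be derivable at 0,
   so it is a subspace for any group H: no closed subgroup theorem is needed. *)
Lemma mem_lie_algebra (R : realType) N (H : mx_group R N) (X : 'M[R]_N) :
  tangent1 H X -> X \in lie_algebra H.
Proof.
have H1 : carrier H 1%:M by case: (mx_groupP H).
have T0 : tangent1 H (0 : 'M[R]_N).
  by exists (fun=> 1%:M); split => //; exact: is_derive_cst.
have [L LE] := vspace_of_set T0 (fun a u v Tu => tangent1D (tangent1Z a Tu)).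
rewrite /lie_algebra => TX; case: xgetP => [V _ VE|/(_ L)/(_ LE)//].
by move: TX; rewrite -VE.
Qed.

(** * Continuity of matrix-valued maps and of quadratic forms *)

Lemma continuous_mx (R : realType) (T : topologicalType) m n
    (F : T -> 'M[R]_(m, n)) :
  (forall i j, continuous (fun t => F t i j)) -> continuous F.
Proof.
move=> cF x; apply/cvgrPdist_le => /= e e0; near=> t.
apply: normmx_bound => [|i j]; first exact: ltW.
rewrite !mxE; move: i j; near: t.
apply: filter_forall => i; apply: filter_forall => j.
exact: (cvgrPdist_le _ _).1 (cF i j x) e e0.
Unshelve. all: by end_near. Qed.

Lemma continuous_entry (R : realType) (T : topologicalType) m n
    (F : T -> 'M[R]_(m, n)) i j :
  continuous F -> continuous (fun t => F t i j).
Proof.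
move=> cF x.
apply: (@continuous_comp _ _ _ F (fun M : 'M[R]_(m, n) => M i j) x (cF x)).
exact: coord_continuous.
Qed.

Lemma continuous_mulmx (R : realType) (T : topologicalType) m n p
    (F : T -> 'M[R]_(m, n)) (G : T -> 'M[R]_(n, p)) :
  continuous F -> continuous G -> continuous (fun t => F t *m G t).
Proof.
move=> cF cG; apply: continuous_mx => i j; under eq_fun do rewrite mxE.
apply: continuous_big => [|k _ t]; first exact: add_continuous.
by apply: continuousM; exact: continuous_entry.
Qed.

Lemma continuous_det (R : realType) (T : topologicalType) n
    (F : T -> 'M[R]_n) :
  continuous F -> continuous (fun t => \det (F t)).
Proof.
move=> cF; apply: continuous_big => [|s _ t]; first exact: add_continuous.
apply: (@continuousM R T (cst ((-1) ^+ s))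
  (fun x => \prod_i F x i (s i)) t); first exact: cst_continuous.
move: t; apply: continuous_big => [|i _]; first exact: mul_continuous.
exact: continuous_entry.
Qed.

Lemma continuous_adj (R : realType) (T : topologicalType) n
    (F : T -> 'M[R]_n) :
  continuous F -> continuous (fun t => \adj (F t)).
Proof.
move=> cF; apply: continuous_mx => i j; under eq_fun do rewrite mxE /cofactor.
move=> t; apply: (@continuousM R T (cst ((-1) ^+ (j + i)))
  (fun t => \det (row' j (col' i (F t)))) t); first exact: cst_continuous.
move: t; apply: continuous_det; apply: continuous_mx => k l.
by under eq_fun do rewrite !mxE; exact: continuous_entry.
Qed.

(** Expanding both arguments over the elementary matrices turns [q X X] into a polynomial in the
    entries of [X]. *)
Lemma continuous_quadratic (R : realType) m n
    (q : 'M[R]_(m, n) -> 'M[R]_(m, n) -> R) :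
  (forall Y, linear (q^~ Y)) -> (forall X, linear (q X)) ->
  continuous (fun X => q X X).
Proof.
move=> ql qr.
have hl (u : 'M[R]_(m, n)) Y :
    q u Y = \sum_i \sum_j u i j * q (delta_mx i j) Y.
  pose f := HB.pack_for {linear 'M[R]_(m, n) -> R^o} (q^~ Y)
    (GRing.isLinear.Build _ _ _ _ _ (ql Y)).
  rewrite -[LHS]/(f _) {1}(matrix_sum_delta u) linear_sum.
  apply: eq_bigr => i _; rewrite linear_sum; apply: eq_bigr => j _.
  by rewrite linearZ.
have hr X (u : 'M[R]_(m, n)) :
    q X u = \sum_i \sum_j u i j * q X (delta_mx i j).
  pose f := HB.pack_for {linear 'M[R]_(m, n) -> R^o} (q X)
    (GRing.isLinear.Build _ _ _ _ _ (qr X)).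
  rewrite -[LHS]/(f _) {1}(matrix_sum_delta u) linear_sum.
  apply: eq_bigr => i _; rewrite linear_sum; apply: eq_bigr => j _.
  by rewrite linearZ.
have cr X : continuous (q X).
  rewrite (_ : q X = fun u => \sum_i \sum_j u i j * q X (delta_mx i j));
    last first.
    by apply/funext => u; exact: hr.
  apply: continuous_big => [|i _]; first exact: add_continuous.
  apply: continuous_big => [|j _ v]; first exact: add_continuous.
  apply: (continuousM (@coord_continuous _ _ _ i j v)).
  exact: cst_continuous.
under eq_fun do rewrite hl.
apply: continuous_big => [|i _]; first exact: add_continuous.
apply: continuous_big => [|j _ v]; first exact: add_continuous.
by apply: (continuousM (@coord_continuous _ _ _ i j v)); exact: cr.
Qed.

(** * Positive definite forms and the Killing norm *)

(** In coordinates on [L], the form attains a positive minimum on the compact unit sphere;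
    homogeneity extends the resulting bound to all of [L]. *)
Lemma norm_le_posdef (R : realType) N (L : {vspace 'M[R]_N})
    (q : 'M[R]_N -> 'M[R]_N -> R) :
  (forall Y, linear (q^~ Y)) -> (forall X, linear (q X)) ->
  (forall X, X \in L -> X != 0 -> 0 < q X X) ->
  exists2 C, 0 <= C & forall X, X \in L -> `|X| <= C * Num.sqrt (q X X).
Proof.
move=> ql qr qpos.
pose b := vbasis L; pose x (v : 'rV[R]_(\dim L)) := \sum_i v 0 i *: b`_i.
have xL v : x v \in L.
  by apply: memv_suml => i _; rewrite memvZ// vbasis_mem// mem_nth// size_tuple.
have x0 v : v != 0 -> x v != 0.
  apply: contra => /eqP xv0; apply/eqP/rowP => i; rewrite mxE.
  rewrite -(coord_sum_free (v 0) i (basis_free (vbasisP L))).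
  by rewrite -/b -/(x v) xv0 linear0.
have xP a v w : x (a *: v + w) = a *: x v + x w.
  rewrite scaler_sumr -big_split/=; apply: eq_bigr => i _.
  by rewrite !mxE scalerDl scalerA.
have qxl w : linear (fun v => q (x v) (x w)).
  by move=> a v v'; rewrite xP ql.
have qxr v : linear (fun w => q (x v) (x w)).
  by move=> a w w'; rewrite xP qr.
have cq := continuous_quadratic qxl qxr.
have qZ a v : q (x (a *: v)) (x (a *: v)) = a ^+ 2 * q (x v) (x v).
  have -> : x (a *: v) = a *: x v.
    by rewrite scaler_sumr; apply: eq_bigr => i _; rewrite mxE scalerA.
  pose f Y := HB.pack_for {linear 'M[R]_N -> R^o} (q^~ Y)
    (GRing.isLinear.Build _ _ _ _ _ (ql Y)).
  pose g X := HB.pack_for {linear 'M[R]_N -> R^o} (q X)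
    (GRing.isLinear.Build _ _ _ _ _ (qr X)).
  rewrite -[LHS]/(f _ _) linearZ -[f _ _]/(g _ _) linearZ.
  by rewrite expr2 -mulrA.
have normx v : `|x v| <= `|v| * \sum_(i < \dim L) `|b`_i|.
  rewrite mulr_sumr (le_trans (ler_norm_sum _ _ _))//.
  by apply: ler_sum => i _; rewrite normrZ ler_wpM2r// normmx_le.
have xE X : X \in L -> X = x (\row_i coord b i X).
  move=> XL; rewrite [LHS](coord_vbasis XL).
  by apply: eq_bigr => i _; rewrite mxE.
pose S := [set v : 'rV[R]_(\dim L) | `|v| = 1].
have cS : compact S.
  apply: bounded_closed_compact.
    exists 1; split; first exact: num_real.
    by move=> y y1 v /= ->; exact: ltW.
  have -> : S = Num.norm @^-1` [set 1] by [].
  by apply: closed_comp => [v _|]; [exact: norm_continuous|exact: closed_eq].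
(* The sphere can be empty only if [L] is zero, and then [C = 0] works. *)
have [SN0|S0] := pselect (S !=set0); last first.
  exists 0 => // X /xE ->; rewrite mul0r normr_le0.
  apply/eqP; apply: contra_notP S0 => /eqP xv0.
  pose v := \row_i coord b i X.
  have v0 : v != 0.
    apply: contra xv0 => /eqP; rewrite -/v => ->; apply/eqP.
    by rewrite /x big1// => i _; rewrite mxE scale0r.
  exists (`|v|^-1 *: v).
  by rewrite /S/= normrZ normfV normr_id mulVf// normr_eq0.
have [v1 v1S v1min] := compact_EVT_min SN0 cS (continuous_subspaceT cq).
have m0 : 0 < q (x v1) (x v1).
  apply: qpos => //; apply: x0; apply/eqP => v10.
  by move: v1S; rewrite inE /S/= v10 normr0 => /eqP; rewrite eq_sym oner_eq0.
set m := q _ _ in m0.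
(* With [m] the minimum on the sphere, [sqrt m * |v| <= sqrt (q X X)]; the sum of the [|b_i|]
   compares [|x v|] with [|v|]. *)
exists ((\sum_(i < \dim L) `|b`_i|) / Num.sqrt m) => [|X /xE ->].
  by rewrite divr_ge0// ?sqrtr_ge0// sumr_ge0.
set v := (X in x X).
have [->|v0'] := eqVneq v 0.
  have -> : x 0 = 0 by rewrite /x big1// => i _; rewrite mxE scale0r.
  by rewrite normr0 mulr_ge0 ?sqrtr_ge0// divr_ge0 ?sqrtr_ge0// sumr_ge0.
have nv0 : 0 < `|v| by rewrite normr_gt0.
have : m <= q (x (`|v|^-1 *: v)) (x (`|v|^-1 *: v)).
  apply: v1min; rewrite inE /S/= normrZ normfV normr_id mulVf//.
  by rewrite gt_eqF.
rewrite qZ exprVn ler_pdivlMl ?exprn_gt0// => mv.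
rewrite (le_trans (normx v))// mulrC -mulrA ler_wpM2l ?sumr_ge0//.
rewrite ler_pdivlMl ?sqrtr_gt0// mulrC -[`|v|]gtr0_norm//.
rewrite -sqrtr_sqr -sqrtrM ?sqr_ge0//.
exact: ler_wsqrtr.
Qed.

Lemma bracket_linearl (R : realType) N (Y : 'M[R]_N) :
  linear ((@bracket R N)^~ Y).
Proof.
move=> a X X'; rewrite /bracket mulmxDl mulmxDr -scalemxAl -scalemxAr.
by rewrite scalerBr opprD addrACA.
Qed.

Lemma bracket_linearr (R : realType) N (X : 'M[R]_N) : linear (bracket X).
Proof.
move=> a Y Y'; rewrite /bracket mulmxDl mulmxDr -scalemxAl -scalemxAr.
by rewrite scalerBr opprD addrACA.
Qed.

Lemma killing_linearl (R : realType) N (L : {vspace 'M[R]_N}) Y :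
  linear (killing L ^~ Y).
Proof.
move=> a X X'; rewrite /killing scaler_sumr -big_split/=.
by apply: eq_bigr => i _; rewrite bracket_linearl linearP.
Qed.

Lemma killing_linearr (R : realType) N (L : {vspace 'M[R]_N}) X :
  linear (killing L X).
Proof.
move=> a Y Y'; rewrite /killing scaler_sumr -big_split/=.
by apply: eq_bigr => i _; rewrite bracket_linearl bracket_linearr linearP.
Qed.

(** The last clause of [cartan_involution] is positive definiteness of the form on the Lie
    algebra. *)
Lemma norm_le_killing_norm (R : realType) N (H : mx_group R N) theta :
  cartan_involution (lie_algebra H) theta ->
  exists2 C, 0 <= C & forall X, X \in lie_algebra H ->
    `|X| <= C * killing_norm H theta X.
Proof.
move=> [_ _ _ pos]; rewrite /killing_norm.
apply: (@norm_le_posdef _ _ _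
  (fun X Y => - killing (lie_algebra H) X (theta Y))).
- by move=> Y a X X'; rewrite killing_linearl opprD -scalerN.
- by move=> X a Y Y'; rewrite linearP killing_linearr opprD -scalerN.
- exact: pos.
Qed.

Lemma continuous_killing_norm (R : realType) N (H : mx_group R N) theta :
  continuous (killing_norm H theta).
Proof.
move=> X; apply: (@continuous_comp _ _ _
  (fun X => - killing (lie_algebra H) X (theta X)) Num.sqrt X);
  last exact: sqrt_continuous.
move: X; apply: (@continuous_quadratic _ _ _
  (fun X Y => - killing (lie_algebra H) X (theta Y))).
- by move=> Y a X X'; rewrite killing_linearl opprD -scalerN.
- by move=> X a Y Y'; rewrite linearP killing_linearr opprD -scalerN.
Qed.

(** * Growth of the matrix norm along curves in the group *)

Lemma invmx_det1 (R : realType) N (h : 'M[R]_N) :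
  \det h = 1 -> h \in unitmx /\ invmx h = \adj h.
Proof.
move=> h1; rewrite /invmx unitmxE h1 unitr1; split => //.
by rewrite invr1 scale1r.
Qed.

(** Right translation by [invmx (c t)] carries the curve to one through the identity. Interior times
    are required since [c] lies in [H] only over the unit interval. *)
Lemma tangent1_curve (R : realType) N (H : mx_group R N) (c : R -> 'M[R]_N)
    (t : R) D :
  (forall s, 0 <= s <= 1 -> carrier H (c s)) -> 0 < t < 1 ->
  is_derive t 1 c D -> tangent1 H (D *m invmx (c t)).
Proof.
move=> cH /andP[t0 t1] dc.
have [_ HM HV] := mx_groupP H.
have [ctU Hct] : c t \in unitmx /\ carrier H (invmx (c t)).
  by apply: HV; apply: cH; rewrite !ltW.
(* tangent1 wants a curve defined on all of R, hence the bounded time change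
   s |-> t + e * sin s, of derivative e at 0. *)
pose e := Num.min t (1 - t).
have e0 : 0 < e by rewrite lt_min t0 subr_gt0.
have -> : D *m invmx (c t) = e^-1 *: (e *: D *m invmx (c t)).
  by rewrite -scalemxAl scalerA mulVf ?scale1r ?gt_eqF.
apply: tangent1Z; pose g (s : R) := t + e * sin s.
have g0 : g 0 = t by rewrite /g sin0 mulr0 addr0.
exists (fun s => c (g s) *m invmx (c t)); split => [s||].
- apply: HM => //; apply: cH.
  have : `|e * sin s| <= e.
    by rewrite normrM gtr0_norm// -[leRHS]mulr1 ler_wpM2l ?(ltW e0) ?sin_max.
  rewrite ler_norml /g => /andP[].
  have : e <= t by rewrite ge_min lexx.
  have : e <= 1 - t by rewrite ge_min lexx orbT.
  by move=> *; apply/andP; split; lra.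
- by rewrite g0 mulmxV.
- have dg : is_derive (0 : R) 1 g e.
    have -> : g = cst t + e *: sin by [].
    by apply: is_derive_eq; rewrite cos0 add0r /GRing.scale/= mulr1.
  rewrite -g0 in dc.
  have := is_derive_mulmx (is_derive_mx_comp dg dc)
    (is_derive_cst (invmx (c t)) (0 : R) 1).
  by rewrite mulmx0 addr0.
Qed.

(** The squared Frobenius norm, which unlike the maximum norm is a polynomial in the entries and can
    be differentiated. *)
Definition sqsum (R : realType) N (A : 'M[R]_N) : R := \sum_i \sum_j A i j ^+ 2.

Lemma sqsum_ge0 (R : realType) N (A : 'M[R]_N) : 0 <= sqsum A.
Proof. by apply: sumr_ge0 => i _; apply: sumr_ge0 => j _; exact: sqr_ge0. Qed.

Lemma normmx_sqsum (R : realType) N (A : 'M[R]_N) : `|A| <= 1 + sqsum A.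
Proof.
apply: normmx_bound => [|i j]; first by rewrite addr_ge0// sqsum_ge0.
have Aij : `|A i j| ^+ 2 <= sqsum A.
  rewrite real_normK ?num_real// /sqsum (bigD1 i)//= (bigD1 j)//= -addrA lerDl.
  rewrite addr_ge0 ?sumr_ge0// => [k _|k _]; first exact: sqr_ge0.
  by apply: sumr_ge0 => l _; exact: sqr_ge0.
by nra.
Qed.

(** When [M] moves with velocity [A *m M], the left side is half the derivative of [sqsum M]. Each
    product of two entries of [M] is at most half the sum of their squares. *)
Lemma sqsum_derive_le (R : realType) N (A M : 'M[R]_N) :
  \sum_i \sum_j M i j * (A *m M) i j <= N%:R * `|A| * sqsum M.
Proof.
have le1 i j : M i j * (A *m M) i j <=
    \sum_k `|A| / 2 * (M i j ^+ 2 + M k j ^+ 2).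
  rewrite mxE mulr_sumr; apply: ler_sum => k _.
  have Aik := normmx_le A i k.
  rewrite (le_trans (ler_norm _))// !normrM mulrCA.
  rewrite (@le_trans _ _ (`|A| * (`|M i j| * `|M k j|)))//.
    by rewrite ler_wpM2r// mulr_ge0.
  rewrite -mulrA ler_wpM2l// -[M i j ^+ 2]real_normK ?num_real//.
  rewrite -[M k j ^+ 2]real_normK ?num_real//.
  by have := sqr_ge0 (`|M i j| - `|M k j|); nra.
rewrite (@le_trans _ _
  (\sum_i \sum_j \sum_k `|A| / 2 * (M i j ^+ 2 + M k j ^+ 2)))//.
  by apply: ler_sum => i _; apply: ler_sum => j _.
have -> : \sum_i \sum_j \sum_k `|A| / 2 * (M i j ^+ 2 + M k j ^+ 2) =
    `|A| / 2 * (\sum_i \sum_j \sum_(k < N) M i j ^+ 2 +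
                \sum_(i < N) \sum_j \sum_k M k j ^+ 2).
  rewrite -big_split mulr_sumr/=; apply: eq_bigr => i _.
  rewrite -big_split mulr_sumr/=; apply: eq_bigr => j _.
  by rewrite -big_split mulr_sumr.
have -> : \sum_i \sum_j \sum_(k < N) M i j ^+ 2 = N%:R * sqsum M.
  rewrite mulr_sumr; apply: eq_bigr => i _; rewrite mulr_sumr.
  by apply: eq_bigr => j _; rewrite sumr_const card_ord mulr_natl.
have -> : \sum_(i < N) \sum_j \sum_k M k j ^+ 2 = N%:R * sqsum M.
  by rewrite sumr_const card_ord mulr_natl /sqsum exchange_big.
by rewrite le_eqVlt; apply/orP; left; apply/eqP; field.
Qed.

Lemma is_derive_ln_sqsum (R : realType) N (c : R -> 'M[R]_N) (t : R) D :
  is_derive t 1 c D ->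
  is_derive t 1 (fun s => ln (1 + sqsum (c s)))
    (2 * (\sum_i \sum_j c t i j * D i j) / (1 + sqsum (c t))).
Proof.
move=> /is_derive_mxP dc.
have dp : is_derive t 1 (fun s => 1 + sqsum (c s))
    (2 * (\sum_i \sum_j c t i j * D i j)).
  have -> : (fun s => 1 + sqsum (c s)) =
      cst 1 + \sum_i \sum_j (fun s => c s i j) ^+ 2.
    apply/funext => s; rewrite /sqsum !fctE fct_sumE; congr (_ + _).
    by apply: eq_bigr => i _; rewrite fct_sumE; apply: eq_bigr => j _.
  have -> : 2 * (\sum_i \sum_j c t i j * D i j) =
      0 + \sum_i \sum_j (2%:R * c t i j ^+ 1) *: D i j.
    rewrite add0r mulr_sumr; apply: eq_bigr => i _; rewrite mulr_sumr.
    by apply: eq_bigr => j _; rewrite /GRing.scale/= expr1 mulrA.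
  apply: is_deriveD; apply: is_derive_sum => i; apply: is_derive_sum => j.
  exact: is_deriveX.
have p0 : 0 < 1 + sqsum (c t) by rewrite ltr_wpDr ?sqsum_ge0.
rewrite [X in is_derive _ _ _ X]mulrC.
exact: (@is_derive1_comp _ (@ln R) (fun s => 1 + sqsum (c s)) t _ _
  (is_derive1_ln p0) dp).
Qed.

(** Writing the velocity as [A *m c t] with [A] in the Lie algebra, the logarithmic derivative is at
    most [2 N |A|], hence at most a multiple of the speed; this is then integrated over the unit
    interval. *)
Lemma curve_growth (R : realType) N (H : mx_group R N) theta C
    (c : R -> 'M[R]_N) :
  (forall h, carrier H h -> \det h = 1) -> 0 <= C ->
  (forall X, X \in lie_algebra H -> `|X| <= C * killing_norm H theta X) ->
  C1_curve H c ->
  ((ln (1 + sqsum (c 1)) - ln (1 + sqsum (c 0)))%:E <=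
   (2 * N%:R * C + 1)%:E * curve_length H theta c)%E.
Proof.
move=> H1 C0 leC [dc cdc cH].
have isd (t : R) : is_derive t 1 c (derive1 c t).
  by apply: DeriveDef => //; rewrite derive1E.
have cc : continuous c.
  by move=> t; apply: differentiable_continuous; apply/derivable1_diffP.
pose K := 2 * N%:R * C + 1.
have K0 : 0 < K by rewrite ltr_wpDl// !mulr_ge0.
pose F (t : R) := ln (1 + sqsum (c t)).
pose w (t : R) :=
  2 * (\sum_i \sum_j c t i j * derive1 c t i j) / (1 + sqsum (c t)).
(* The speed, with the adjugate in place of the inverse: the two agree on [H], and the adjugate
   keeps [v] continuous at times when [c] may have left [H]. *)
pose v (t : R) := killing_norm H theta (derive1 c t *m \adj (c t)).
have dF (t : R) : is_derive t 1 F (w t) := is_derive_ln_sqsum (isd t).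
have csum : continuous (fun t : R => 1 + sqsum (c t)).
  have -> : (fun t => 1 + sqsum (c t)) = cst 1 + (fun t => sqsum (c t)) by [].
  move=> t; apply: continuousD; first exact: cst_continuous.
  move: t; apply: continuous_big => [|i _]; first exact: add_continuous.
  apply: continuous_big => [|j _ t]; first exact: add_continuous.
  apply: (@continuous_comp _ _ _ (fun t => c t i j) (fun x => x ^+ 2)).
    exact: continuous_entry.
  exact: exprn_continuous.
have cw : continuous w.
  move=> t; apply: (@continuousM _ _
    (fun t => 2 * (\sum_i \sum_j c t i j * derive1 c t i j))
    (fun t => (1 + sqsum (c t))^-1)); last first.
    apply: (@continuousV _ _ (fun t => 1 + sqsum (c t))); last exact: csum.
    by rewrite gt_eqF// ltr_wpDr ?sqsum_ge0.
  apply: (@continuousM _ _ (cst 2)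
    (fun t => \sum_i \sum_j c t i j * derive1 c t i j)).
    exact: cst_continuous.
  move: t; apply: continuous_big => [|i _]; first exact: add_continuous.
  apply: continuous_big => [|j _ t]; first exact: add_continuous.
  apply: (@continuousM _ _ (fun t => c t i j) (fun t => derive1 c t i j)).
    exact: continuous_entry.
  exact: continuous_entry.
have cv : continuous v.
  move=> t.
  apply: (@continuous_comp _ _ _ (fun t => derive1 c t *m \adj (c t))).
    by apply: continuous_mulmx => //; exact: continuous_adj.
  exact: continuous_killing_norm.
have v0 t : 0 <= v t by exact: sqrtr_ge0.
(* The endpoints are discarded because [tangent1_curve] applies at interior times only. *)
have -> : curve_length H theta c =
    (\int[lebesgue_measure]_(t in `]0%R, 1%R[) (v t)%:E)%E.
  rewrite /curve_length -(@integral_itv_bndoo _ 0 1 _ true false); last first.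
    apply/measurable_EFinP; apply: measurable_funTS.
    exact: continuous_measurable_fun.
  apply: eq_integral => t; rewrite inE/= in_itv/= => /cH Hct.
  by have [_ ->] := invmx_det1 (H1 _ Hct).
rewrite -ge0_integralZl//; last 3 first.
- apply/measurable_EFinP; apply: measurable_funTS.
  exact: continuous_measurable_fun.
- by move=> t _; rewrite lee_fin.
- by rewrite lee_fin; exact: ltW.
have -> : (ln (1 + sqsum (c 1)) - ln (1 + sqsum (c 0)))%:E =
    (\int[lebesgue_measure]_(t in `[0%R, 1%R]) (w t)%:E)%E.
  rewrite (@continuous_FTC2 _ w F)//.
  - exact: continuous_subspaceT.
  - have cF : continuous F.
      move=> t; apply: differentiable_continuous; apply/derivable1_diffP.
      by have [] := dF t.
    split => [t _| |]; first by have [] := dF t.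
    + by apply: cvg_at_right_filter; exact: cF.
    + by apply: cvg_at_left_filter; exact: cF.
  - by move=> t _; rewrite derive1E; have [] := dF t.
rewrite (@integral_itv_bndoo _ 0 1 _ true false); last first.
  apply/measurable_EFinP; apply: measurable_funTS.
  exact: continuous_measurable_fun.
have int_cont (f : R -> R) : continuous f ->
    lebesgue_measure.-integrable `]0%R, 1%R[ (EFin \o f).
  move=> cf.
  apply: (@integrableS _ _ _ lebesgue_measure `[0%R, 1%R]%classic) => //.
    exact: subset_itv_oo_cc.
  apply: continuous_compact_integrable; first exact: segment_compact.
  exact: continuous_subspaceT.
apply: le_integral => //.
- exact: int_cont.
- have -> : (fun t => K%:E * (v t)%:E)%E = EFin \o (fun t => K * v t).
    by apply/funext => t; rewrite /= EFinM.
  apply: int_cont => t; apply: (@continuousM _ _ (cst K) v); last exact: cv.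
  exact: cst_continuous.
- move=> t; rewrite inE/= in_itv/= => t01.
  have Hct : carrier H (c t) by apply: cH; case/andP: t01 => *; rewrite !ltW.
  have [cU cV] := invmx_det1 (H1 _ Hct).
  rewrite -EFinM lee_fin /w.
  set A := derive1 c t *m invmx (c t).
  have dE : derive1 c t = A *m c t by rewrite /A mulmxKV.
  have AL : A \in lie_algebra H.
    by apply: mem_lie_algebra; exact: tangent1_curve.
  rewrite ler_pdivrMr; last by rewrite ltr_wpDr ?sqsum_ge0.
  rewrite dE (le_trans (ler_wpM2l _ (sqsum_derive_le _ _)))//.
  have := leC _ AL; rewrite /A cV -/A -/(v t) => leA.
  have := sqsum_ge0 (c t); have := v0 t; rewrite /K.
  set p := sqsum _ => vt0 p0.
  rewrite -/(v t) in leA.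
  (* It remains to chain [2 N |A| p <= 2 N C v p <= K v (1 + p)], where [v] is the speed. *)
  rewrite (@le_trans _ _ (2 * (N%:R * (C * v t) * p)))//.
    by rewrite ler_wpM2l// ler_wpM2r// ler_wpM2l.
  have : 0 <= N%:R * (C * v t) by rewrite !mulr_ge0.
  by nra.
Qed.

(** The differences of logarithms telescope along the concatenated pieces. *)
Lemma pw_curve_growth (R : realType) N (H : mx_group R N) theta C g h l :
  (forall h, carrier H h -> \det h = 1) -> 0 <= C ->
  (forall X, X \in lie_algebra H -> `|X| <= C * killing_norm H theta X) ->
  pw_curve H theta g h l ->
  ((ln (1 + sqsum h) - ln (1 + sqsum g))%:E <=
   (2 * N%:R * C + 1)%:E * l)%E.
Proof.
move=> H1 C0 leC gh.
(* Nonnegativity of the length is carried through the induction so that multiplication distributes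
   over the sum in the extended reals. *)
suff [] : (0 <= l)%E /\ ((ln (1 + sqsum h) - ln (1 + sqsum g))%:E <=
   (2 * N%:R * C + 1)%:E * l)%E by [].
elim: gh => {g h l} [g _|c h l cC1 _ [l0 IH]]; first by rewrite subrr mule0.
have c0 : (0 <= curve_length H theta c)%E.
  by apply: integral_ge0 => t _; rewrite lee_fin sqrtr_ge0.
split; first exact: adde_ge0.
rewrite ge0_muleDr//.
have -> : ln (1 + sqsum h) - ln (1 + sqsum (c 0)) =
    (ln (1 + sqsum (c 1)) - ln (1 + sqsum (c 0))) +
    (ln (1 + sqsum h) - ln (1 + sqsum (c 1))) by ring.
by rewrite EFinD leeD//; exact: curve_growth.
Qed.

(** * Comparison of Riemannian balls with matrix balls *)

(** A point of the ball is joined to the identity by a curve of length less than [r], so its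
    logarithm exceeds that of the identity by at most [K * r]. *)
Lemma riemannian_ball_bounded (R : realType) N (H : mx_group R N) theta r :
  (forall h, carrier H h -> \det h = 1) ->
  cartan_involution (lie_algebra H) theta ->
  exists2 M, 0 <= M & forall h, riemannian_ball H theta r h -> `|h| <= M.
Proof.
move=> H1 /norm_le_killing_norm[C C0 leC].
pose K := 2 * N%:R * C + 1.
have K0 : 0 < K by rewrite ltr_wpDl// !mulr_ge0.
exists (expR (ln (1 + sqsum (1%:M : 'M[R]_N)) + K * r)); first exact: expR_ge0.
move=> h [_ /ereal_inf_lt[l /= hl lr]].
have := pw_curve_growth H1 C0 leC hl; rewrite -/K => Kl.
have : ((ln (1 + sqsum h) - ln (1 + sqsum (1%:M : 'M[R]_N)))%:E <=
    (K * r)%:E)%E.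
  by rewrite (le_trans Kl)// EFinM lee_wpmul2l ?lee_fin ?ltW.
rewrite lee_fin lerBlDl -ler_expR lnK; last first.
  by rewrite posrE ltr_wpDr ?sqsum_ge0.
exact/le_trans/normmx_sqsum.
Qed.

Lemma riemannian_ball_matrix_ball (R : realType) N (H : mx_group R N) theta r :
  (forall h, carrier H h -> \det h = 1) ->
  cartan_involution (lie_algebra H) theta ->
  exists2 rho, 0 < rho & forall a b, riemannian_ball H theta r a ->
    riemannian_ball H theta r b -> matrix_ball H rho (invmx b *m a).
Proof.
move=> H1 /(riemannian_ball_bounded r)-/(_ H1)[M M0 leM].
pose M' : R := (N.-1)`!%:R * M ^+ N.-1.
have leM' a : riemannian_ball H theta r a -> `|invmx a| <= M'.
  move=> aB; have [_ ->] := invmx_det1 (H1 _ aB.1).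
  rewrite (le_trans (normmx_adj_le _))// ler_wpM2l//.
  by apply: lerXn2r; rewrite ?nnegrE//; exact: leM.
have M'0 : 0 <= M' by rewrite mulr_ge0// exprn_ge0.
have lt_rho (A : 'M[R]_N) : `|A| <= N%:R * (M' * M) ->
    `|A - 1%:M| < N%:R * (M' * M) + 2.
  move=> leA; rewrite (le_lt_trans (ler_normB _ _))//.
  apply: ler_ltD => //; apply: le_lt_trans (_ : 1 < 2); last by rewrite ltr1n.
  apply: normmx_bound => // i j; rewrite mxE.
  by case: eqP => _; rewrite ?normr1 ?normr0.
have [_ HM HV] := mx_groupP H.
have le_prod a b : riemannian_ball H theta r a -> riemannian_ball H theta r b ->
    `|invmx b *m a| <= N%:R * (M' * M).
  move=> aB bB; rewrite (le_trans (normmxM_le _ _))// ler_wpM2l// ler_pM//.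
    exact: leM'.
  exact: leM.
(* The product is bounded by [N * (M' * M)], the identity matrix by 1; the constant 2 makes the
   inequality strict. *)
exists (N%:R * (M' * M) + 2) => [|a b aB bB].
  by apply: ltr_wpDl => //; rewrite mulr_ge0// mulr_ge0.
have [bU Hb] := HV _ bB.1; have [aU Ha] := HV _ aB.1.
have [abU _] := HV _ (HM _ _ Hb aB.1).
have abV : invmx (invmx b *m a) = invmx a *m b.
  by rewrite -[RHS](mulKmx abU) -!mulmxA (mulKVmx aU) mulVmx// mulmx1.
split; first exact: (HM _ _ Hb aB.1).
  exact: lt_rho (le_prod _ _ aB bB).
(* The inverse has the same shape with [a] and [b] exchanged. *)
by rewrite abV; exact: lt_rho (le_prod _ _ bB aB).
Qed.

(** * Borel measurability and weak convergence *)

Lemma continuous_measurable_Borel (T U : ptopologicalType) (f : T -> U) :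
  continuous f -> measurable_fun setT (f : Borel T -> Borel U).
Proof.
move=> /continuousP cf.
apply: (@measurability _ _ _ (Borel U) _ _ (@open U)) => //.
move=> _ [B oB <-]; rewrite setTI; apply: sub_sigma_algebra; exact: cf.
Qed.

Lemma continuous_measurable_Borel_real (R : realType) (T : ptopologicalType)
    (f : T -> R) :
  continuous f -> measurable_fun setT (f : Borel T -> R).
Proof.
move=> /continuousP cf; apply: (measurability _ (RGenOpens.measurableE R)).
move=> _ [_ [a [b ->] <-]]; rewrite setTI; apply: sub_sigma_algebra.
exact/cf/interval_open.
Qed.

(** The indicator of the zero set cannot in general be tested against weak convergence, so it is
    dominated by the bounded continuous functions [phi k], whose integrals for [mu] tend to 0. *)
Lemma weak_cvg_zero_set (R : realType) (T : ptopologicalType)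
    (mu : {measure set (Borel T) -> \bar R}) (Y : nat -> ptopologicalType)
    (nu : forall n, probability (Borel (Y n)) R)
    (g : forall n, Borel (Y n) -> Borel T) (f : T -> R) :
  (forall n, measurable_fun setT (g n)) ->
  weak_cvg (fun n => pushforward (nu n) (g n)) mu ->
  continuous f -> (forall x, 0 <= f x) -> {ae mu, forall x, 0 < f x} ->
  (fun n => nu n (g n @^-1` [set x | f x = 0])) @ \oo --> 0%E.
Proof.
move=> mg weak cf f0 f_gt0.
have push_int n (phi : T -> R) : continuous phi -> (forall x, 0 <= phi x) ->
    (\int[pushforward (nu n) (g n)]_(x in [set: Borel T]) (phi x)%:E =
     \int[nu n]_x (phi (g n x))%:E)%E.
  move=> cphi phi0; rewrite ge0_integral_pushforward//.
    by apply/measurable_EFinP; exact: continuous_measurable_Borel_real.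
  by move=> x _; rewrite lee_fin.
(* Testing against the constant 1 shows that no mass is lost; this makes the constant 1 an
   integrable dominating function for [mu]. *)
have mu1 : mu setT = 1%E.
  have c1 : continuous (cst 1 : T -> R) by move=> x; exact: cst_continuous.
  have b1 : exists C : R, forall x, `|(cst 1 : T -> R) x| <= C.
    by exists 1 => x; rewrite normr1.
  have cvg1 := weak _ c1 b1.
  rewrite -[LHS]mul1e -(@integral_cst _ _ _ mu setT)//.
  rewrite -(cvg_lim (@ereal_hausdorff R) cvg1); apply: lim_near_cst => //.
  apply: nearW => n; rewrite push_int//= integral_cst// mul1e.
  exact: probability_setT.
(* Equal to 1 where [f] vanishes, and to 0 as soon as [k >= 1 / f x] where [f] is positive. *)
pose phi k x := Num.max 0 (1 - k%:R * f x).
have cphi k : continuous (phi k).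
  move=> x; apply: (@continuous_max _ _ (cst 0) (fun x => 1 - k%:R * f x)).
    exact: cst_continuous.
  have -> : (fun x => 1 - k%:R * f x) = cst 1 - (fun x => k%:R * f x) by [].
  apply: continuousB; first exact: cst_continuous.
  apply: (@continuousM _ _ (cst k%:R) f); last exact: cf.
  exact: cst_continuous.
have phi0 k x : 0 <= phi k x by rewrite le_max lexx.
have phi1 k x : phi k x <= 1.
  by rewrite ge_max ler01 gerBl mulr_ge0.
have phi_bnd k : exists C : R, forall x, `|phi k x| <= C.
  by exists 1 => x; rewrite ger0_norm.
have mphi k : measurable_fun setT (fun x : Borel T => (phi k x)%:E).
  by apply/measurable_EFinP; exact: continuous_measurable_Borel_real.
have mu_phi : (fun k => \int[mu]_(x in setT) (phi k x)%:E)%E @ \oo --> 0%E.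
  rewrite -[X in _ --> X](integral0 mu setT).
  have [] := @dominated_convergence _ (Borel T) R mu setT measurableT
    (fun k x => (phi k x)%:E) (cst 0%E) (cst 1%E) mphi => //.
  - apply: (@filterS _ _ (ae_filter_ringOfSetsType mu) _ _ _ f_gt0) => x fx _.
    apply: cvg_near_cst.
    near=> k; apply/eqP; rewrite eqe; apply/eqP/max_idPl.
    rewrite subr_le0 -ler_pdivrMr//; near: k; exact: nbhs_infty_ger.
  - apply/integrableP; split => //.
    under eq_integral do rewrite /= normr1.
    by rewrite integral_cst// mul1e mu1 ltry.
  - by apply: aeW => x k _ /=; rewrite lee_fin ger0_norm.
have mZ n : measurable (g n @^-1` [set x | f x = 0]).
  rewrite -[_ @^-1` _]setTI; apply: mg => //.
  have -> : [set x | f x = 0] = f @^-1` [set 0] by [].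
  rewrite -[_ @^-1` _]setTI; exact: continuous_measurable_Borel_real.
have le_phi k n : (nu n (g n @^-1` [set x | f x = 0%R]) <=
    \int[pushforward (nu n) (g n)]_(x in [set: Borel T]) (phi k x)%:E)%E.
  rewrite push_int// -[X in nu n X]setIT -integral_indic//.
  apply: ge0_le_integral => //.
  - exact/measurable_EFinP/measurable_indic.
  - exact: measurableT_comp (mphi k) (mg n).
  - move=> y _; rewrite lee_fin indicE.
    have [/set_mem /= fy|_] := boolP (y \in _); last exact: phi0.
    by rewrite /phi fy mulr0 subr0 le_max lexx orbT.
apply/fine_cvgP; split.
  by apply: nearW => n; exact: fin_num_measure.
apply/cvgr0Pnorm_le => e e0.
(* First [k0] is fixed using [mu] alone; only then is [n] taken large for the single test function
   [phi k0]. *)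
have [k0 _ /(_ k0 (leqnn k0)) mu_phi_lt] :
    \forall k \near \oo, (\int[mu]_(x in setT) (phi k x)%:E < e%:E)%E.
  by apply: (mu_phi _ (@open_ereal_lt' _ 0%E e%:E _)); rewrite lte_fin.
have : \forall n \near \oo, (\int[pushforward (nu n) (g n)]_(x in setT)
    (phi k0 x)%:E < e%:E)%E.
  exact: (weak _ (cphi k0) (phi_bnd k0) _ (open_ereal_lt' mu_phi_lt)).
apply: filterS => n /= lt_e; rewrite ger0_norm ?fine_ge0//.
rewrite -lee_fin fineK; last by apply: fin_num_measure; exact: mZ.
exact: le_trans (le_phi k0 n) (ltW lt_e).
Unshelve. all: by end_near. Qed.

(** * Orbit maps, stabilizers and the injectivity radius *)

Lemma continuous_act_point (R : realType) N (H : mx_group R N)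
    (T : topologicalType) (act : 'M[R]_N -> T -> T) x :
  continuous_action H act -> continuous (fun h : set_type H => act (\val h) x).
Proof.
move=> [_ cact]; rewrite -[fun h => _]/(sigL H (act^~ x)).
apply/subspace_sigL_continuousP/subspace_continuousP => g Hg U actU.
move/subspace_continuousP : cact => /(_ (g, x)) /= /(_ (conj Hg I) U actU).
case=> -[P Q] /= [gP xQ] PQU; rewrite nbhs_filterE /within/=.
apply: filterS gP => h Ph Hh.
by apply: (PQU (h, x)) => //=; split => //; exact: nbhs_singleton.
Qed.

Section orbit.
Context (R : realType) (N : nat) (H : mx_group R N) (T : ptopologicalType).
Variables (act : 'M[R]_N -> T -> T) (x : T).
Hypothesis act_action : is_action H act.

(** Representatives of one coset differ on the right by an element fixing [x], so the choice made by
    [get] does not affect the value. *)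
Lemma orbit_map_lmul (y : Borel (coset_space H (stab H act x))) :
  exists2 h, carrier H h /\ \val y = lmul h (stab H act x) &
    orbit_map y = act h x.
Proof.
have [H1 HM HV] := mx_groupP H.
case: y => y yH; have [h Hh hy] := set_mem yH; exists h; first by split.
rewrite /orbit_map /=; case: xgetP => [g _|/(_ h)].
  rewrite -hy => -[d [Hd dx] <-].
  by rewrite act_action.2// dx.
(* The coset contains its representative [h], so the default value of [get] cannot occur. *)
rewrite -hy => /(_ _)/wrap[] //; exists 1%:M; last exact: mulmx1.
by split => //; exact: act_action.1.
Qed.

End orbit.

(** Openness in the quotient topology is tested after [coset_proj], where the orbit map becomes the
    continuous map sending [h] to [act h x]. *)
Lemma orbit_map_continuous (R : realType) (N : nat) (H : mx_group R N)
    (T : ptopologicalType) (act : 'M[R]_N -> T -> T) (x : T) :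
  continuous_action H act ->
  continuous (@orbit_map R N H T act x : coset_space H (stab H act x) -> T).
Proof.
move=> cact; apply/continuousP => U oU.
suff -> : open ((@orbit_map R N H T act x) @^-1` U) =
    open ((fun h : set_type H => act (\val h) x) @^-1` U).
  by have /continuousP := @continuous_act_point _ _ _ _ _ x cact; exact.
rewrite [LHS]/(coset_open _) /coset_open; congr open.
apply/funext => h /=; congr U.
have [g [Hg hg] ->] := orbit_map_lmul cact.1 (coset_proj (stab H act x) h).
have [H1 _ _] := mx_groupP H.
have [d [Hd dx] <-] : lmul g (stab H act x) (\val h).
  rewrite -hg /=; exists 1%:M; last exact: mulmx1.
  by split => //; exact: cact.1.1.
by rewrite cact.1.2// dx.
Qed.

Lemma small_injectivity_radius (R : realType) (N : nat) (H : mx_group R N)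
    (theta : 'End('M[R]_N)) (T : ptopologicalType) (act : 'M[R]_N -> T -> T)
    (x : T) (y : Borel (coset_space H (stab H act x))) r :
  is_action H act -> 0 < r -> (injectivity_radius theta y < r%:E)%E ->
  exists a b, [/\ riemannian_ball H theta r a, riemannian_ball H theta r b,
    invmx b *m a != 1%:M & stab H act (orbit_map y) (invmx b *m a)].
Proof.
move=> actH r0 yr; have [_ HM HV] := mx_groupP H.
(* Otherwise [r] would belong to the set whose supremum is the injectivity radius. *)
have : ~ set_inj (riemannian_ball H theta r) (fun h => lmul h (\val y)).
  move=> inj; move: yr; apply/negP; rewrite -leNgt.
  by apply: ereal_sup_ubound; exists r.
move=> ninj; apply: contrapT => none; apply: ninj => a b aB bB ab.
move/set_mem : (aB) => aB'; move/set_mem : (bB) => bB'.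
have [bU Hb] := HV _ bB'.1.
apply: contrapT => neq_ab; apply: none; exists a, b; split => //.
  by apply/eqP => ba1; apply: neq_ab; rewrite -[LHS](mulKVmx bU) ba1 mulmx1.
have [h [Hh yh] ->] := orbit_map_lmul actH y.
have Sh : lmul h (stab H act x) h.
  exists 1%:M; last exact: mulmx1.
  by split; [have [] := mx_groupP H|exact: actH.1].
(* Equality of the translated cosets gives [a h = b h d] with [d] fixing [x], so [invmx b *m a]
   fixes [act h x]. *)
have : lmul b (\val y) (a *m h) by rewrite -ab yh; exists h.
rewrite yh => -[_ [d [Hd dx] <-] bhd].
split; first exact: (HM _ _ Hb aB'.1).
rewrite -actH.2//; last exact: (HM _ _ Hb aB'.1).
by rewrite -mulmxA -bhd mulKmx// actH.2// dx.
Qed.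

(** * Benjamini-Schramm convergence of the periodic orbits *)

Theorem proposition1p1 (R : realType) (N : nat) (H : mx_group R N)
    (H_semisimple : semisimple_group H) (H_noncompact : ~ compact H)
    (theta : 'End('M[R]_N))
    (theta_cartan : cartan_involution (lie_algebra H) theta)
    (X : ptopologicalType) (mu : {measure set (Borel X) -> \bar R})
    (act : 'M[R]_N -> X -> X)
    (act_continuous : continuous_action H act)
    (act_preserving : measure_preserving H act mu)
    (stab_discrete : forall x, discrete_set (stab H act x))
    (x : nat -> X)
    (x_periodic : forall n, periodic_orbit H act (x n))
    (nu : forall n, probability (Borel (coset_space H (stab H act (x n)))) R)
    (nu_invariant : forall n, invariant_probability (nu n))
    (orbit_cvg : weak_cvg
      (fun n => pushforward (nu n) (@orbit_map R N H X act (x n))) mu)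
    (f_exists : forall rho : R, 0 < rho ->
      exists f : X -> R,
        [/\ continuous f,
            forall y, 0 <= f y,
            {ae mu, forall y, 0 < f y} &
            forall y, 0 < f y ->
              stab H act y `&` matrix_ball H rho = [set 1%:M]]) :
  benjamini_schramm theta nu.
Proof.
move=> r r0; have [H1 _ _ _] := H_semisimple.
have [rho rho0 ball_rho] := riemannian_ball_matrix_ball r H1 theta_cartan.
have [f [cf f0 f_gt0 f_stab]] := f_exists _ rho0.
have mo n : measurable_fun setT (@orbit_map R N H X act (x n)).
  by apply: continuous_measurable_Borel; exact: orbit_map_continuous.
have cvg0 := weak_cvg_zero_set mo orbit_cvg cf f0 f_gt0.
apply: (squeeze_cvge _ (cvg_cst 0%E) cvg0); apply: nearW => n.
rewrite mu_ext_ge0//=.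
(* Monotonicity of the outer measure reduces the claim to the preimage of the zero set of [f], which
   is measurable, so there the outer measure is [nu n]. *)
apply: (@le_trans _ _
  ((nu n)^*%mu (@orbit_map R N H X act (x n) @^-1` [set y | f y = 0])));
  last first.
  rewrite measurable_mu_extE// -[_ @^-1` _]setTI; apply: mo => //.
  have -> : [set y | f y = 0] = f @^-1` [set 0] by [].
  rewrite -[_ @^-1` _]setTI; exact: continuous_measurable_Borel_real.
apply: le_mu_ext => y /= yr.
have [a [b [aB bB ba1 ba_stab]]] :=
  small_injectivity_radius act_continuous.1 r0 yr.
(* Were [f] positive at this point of the orbit, its stabilizer would meet the ball of radius [rho]
   only in the identity. *)
apply: contrapT => /eqP fy.
have fy0 : 0 < f (orbit_map y) by rewrite lt_def fy f0.
have : [set 1%:M] (invmx b *m a).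
  by rewrite -(f_stab _ fy0); split => //; exact: ball_rho.
by move=> /eqP; rewrite (negbTE ba1).
Qed.
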